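(* Let $(X,\mathfrak V)$ be an iterated function system with the Gluing Orbit Property, and suppose that $\mathrm{Tran}(X,\mathfrak V,\sigma)\neq\emptyset$ for some $\sigma\in\Sigma$ that is not uniformly rigid. Then $h(X,\mathfrak V)>0$, where $h$ denotes topological entropy.
   Context: Iterated function system: $X$ is a compact metric space with metric $d$, and $\mathfrak V$ is a (possibly infinite) family of homeomorphisms $v:D(v)\to v(D(v))\subset X$ with closed domain $D(v)\subset X$. The pair $(X,\mathfrak V)$ is an iterated function system (IFS) if there is a set $O\subset X$ with $\emptyset\neq\bigcup_{v\in\mathfrak V}v(D(v)\cap O)\subset\bigcup_{v\in\mathfrak V}(D(v)\cap O)$. Orbits: $\mathbb N=\{1,2,\dots\}$, $\Sigma=\mathfrak V^{\mathbb N}$ is the set of sequences $\sigma=(v_1,v_2,\dots)$ with $v_i\in\mathfrak V$. For $\sigma\in\Sigma$ and $x\in X$, $v^{\sigma(n)}(x)=v_n\circ\cdots\circ v_1(x)$ whenever well defined, $v^{\sigma(0)}(x)=x$. $\Sigma_x=\{\sigma\in\Sigma: v^{\sigma(n)}(x)\text{ is well defined for all }n\in\mathbb N\}$, $\Sigma_\sigma=\{x\in X: v^{\sigma(n)}(x)\text{ is well defined for all }n\in\mathbb N\}$, and $\Psi(X)=\{(x,\sigma):x\in X,\sigma\in\Sigma_x\}$. Entropy: $R\subset\Psi(X)$ is $(n,\epsilon)$-spanning if for every $(x,\sigma)\in\Psi(X)$ there is $(y,\varphi)\in R$ with $d(v^{\sigma(i)}(x),v^{\varphi(i)}(y))<\epsilon$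 for all $0\le i\le n-1$; $r(n,\epsilon)$ is the minimum cardinality of such a set. $h(X,\mathfrak V)=\lim_{\epsilon\to0}\limsup_{n\to\infty}\frac1n\log r(n,\epsilon)$. Gluing Orbit Property: an orbit sequence is a finite or infinite sequence $\mathcal C=\{(x_j,\sigma_j,m_j)\}_{1\le j\le N}$ ($N\in\mathbb N\cup\{\infty\}$) with $x_j\in X$, $\sigma_j\in\Sigma_{x_j}$, $m_j\in\mathbb N$; if $N$ is finite, $m_N=+\infty$ is also allowed. A gap is a sequence $\mathcal G=\{t_j\}_{1\le j\le N-1}$ of positive integers. For $\epsilon>0$, $(\mathcal C,\mathcal G)$ is $\epsilon$-traced by $(z,\sigma)\in\Psi(X)$ if for all $1\le j\le N$ (all $j\in\mathbb N$ if $N=\infty$), $d(v^{\sigma(s_j+l)}(z),v^{\sigma_j(l)}(x_j))<\epsilon$ for $l=0,\dots,m_j-1$ (all $l\ge 0$ if $m_j=+\infty$), where $s_1=0$ and $s_j=\sum_{i=1}^{j-1}(m_i+t_i-1)$. $(X,\mathfrak V)$ has the Gluing Orbit Property if for each $\epsilon>0$ there is $M=M(\epsilon)\in\mathbb N$ such that for each orbit sequence $\mathcal C$ there is a gap $\mathcal G$ with all entries in $\{1,\dots,M\}$ such that $(\mathcal C,\mathcal G)$ is $\epsilon$-traced by some element of $\Psi(X)$. Transitivity and rigidity: $\mathrm{Tran}(X,\mathfrak V,\sigma)$ is the set of $p\in X$ with $\sigma\in\Sigma_p$ such that $\{v^{\sigma(n)}(p):n\in\mathbb N\}$ is dense in $X$.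 $\sigma\in\Sigma$ is uniformly rigid if there is a sequence $\{m_k\}$ in $\mathbb N$ such that $v^{\sigma(m_k)}\to\mathrm{Id}$ uniformly (on $\Sigma_\sigma$) as $k\to\infty$. *)

(* Defs.v *)
From HB Require Import structures.
From mathcomp Require Import all_boot all_order all_algebra.
From mathcomp Require Import all_classical all_reals all_analysis.

Set Implicit Arguments.
Unset Strict Implicit.
Unset Printing Implicit Defensive.

Import Order.TTheory GRing.Theory Num.Theory.
Import numFieldNormedType.Exports.

Local Open Scope classical_set_scope.
Local Open Scope ring_scope.

(* A homeomorphism v : D(v) -> v(D(v)) between subsets of T, D(v) closed.
   It is carried by a total function whose values outside [dom] are junk:
   every definition below evaluates it only on its domain. *)
Record partial_homeo (T : topologicalType) := PartialHomeo {
  dom : set T ;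
  pfun :> T -> T ;
  dom_closed : closed dom ;
  pfun_continuous : {within dom, continuous pfun} ;
  pfun_inverse : exists g : T -> T,
    {within pfun @` dom, continuous g} /\ {in dom, cancel pfun g} }.

(* Extended natural numbers are encoded in [option nat], [None] being +oo. *)
Definition lt_enat (j : nat) (n : option nat) : Prop :=
  if n is Some k then (j < k)%N else True.

Section IteratedFunctionSystem.
Context {R : realType} {X : metricType R} {V : Type}.
(* The family of homeomorphisms is indexed by V; a sequence (v_1, v_2, ...)
   of its members is sigma : nat -> V with v_i = v (sigma i.-1). *)
Variable v : V -> partial_homeo X.

Definition is_IFS : Prop := exists O : set X,
  \bigcup_(a in [set: V]) (v a @` (dom (v a) `&` O)) !=set0 /\
  \bigcup_(a in [set: V]) (v a @` (dom (v a) `&` O)) `<=`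
    \bigcup_(a in [set: V]) (dom (v a) `&` O).

Fixpoint ifs_iter (sigma : nat -> V) (n : nat) (x : X) : X :=
  if n is k.+1 then v (sigma k) (ifs_iter sigma k x) else x.

Definition well_defined (sigma : nat -> V) (n : nat) (x : X) : Prop :=
  forall k, (k < n)%N -> dom (v (sigma k)) (ifs_iter sigma k x).

Definition Sigma_pt (x : X) : set (nat -> V) :=
  [set sigma | forall n, (1 <= n)%N -> well_defined sigma n x].

Definition Sigma_seq (sigma : nat -> V) : set X :=
  [set x | forall n, (1 <= n)%N -> well_defined sigma n x].

Definition Psi : set (X * (nat -> V)) := [set p | Sigma_pt p.1 p.2].

Definition spanning (n : nat) (eps : R) (S : set (X * (nat -> V))) : Prop :=
  S `<=` Psi /\
  forall p, Psi p -> exists2 q, S q & forall i, (i < n)%N ->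
    mdist (ifs_iter p.2 i p.1) (ifs_iter q.2 i q.1) < eps.

(* The minimum cardinality of an (n, eps)-spanning set; the infimum is over
   the finite ones, hence +oo if all spanning sets are infinite. *)
Definition min_spanning (n : nat) (eps : R) : \bar R :=
  ereal_inf [set k%:R%:E | k in
    [set k : nat | exists2 S, spanning n eps S & (S #= `I_k)%card]].

Definition entropy : \bar R :=
  lim (limn_esup (fun n => (n%:R^-1)%:E * lne (min_spanning n eps))%E
       @[eps --> 0^'+]).

(* Orbit sequences and gaps are indexed from 0: the j-th entry here is the
   (j+1)-th one in the usual numbering 1 <= j <= N.  Entries at indices
   >= N are irrelevant. *)
Definition orbit_sequence (N : option nat)
    (x : nat -> X) (s : nat -> nat -> V) (m : nat -> option nat) : Prop :=
  lt_enat 0 N /\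
  forall j, lt_enat j N ->
    Psi (x j, s j) /\
    (if m j is Some k then (1 <= k)%N else N = Some j.+1).

Definition start (m : nat -> option nat) (t : nat -> nat) (j : nat) : nat :=
  (\sum_(i < j) (odflt 0 (m i) + t i - 1))%N.

Definition traced (eps : R) (N : option nat) (x : nat -> X)
    (s : nat -> nat -> V) (m : nat -> option nat) (t : nat -> nat)
    (z : X) (sigma : nat -> V) : Prop :=
  forall j, lt_enat j N -> forall l, lt_enat l (m j) ->
    mdist (ifs_iter sigma (start m t j + l) z) (ifs_iter (s j) l (x j)) < eps.

Definition gluing_orbit_property : Prop :=
  forall eps : R, 0 < eps -> exists2 M : nat, (1 <= M)%N &
    forall N x s m, orbit_sequence N x s m ->
      exists t : nat -> nat,
        (forall j, lt_enat j.+1 N -> (1 <= t j <= M)%N) /\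
        exists2 p, Psi p & traced eps N x s m t p.1 p.2.

Definition Tran (sigma : nat -> V) : set X :=
  [set p | Sigma_pt p sigma /\
    dense [set ifs_iter sigma n p | n in [set n | (1 <= n)%N]]].

Definition uniformly_rigid (sigma : nat -> V) : Prop :=
  exists2 m : nat -> nat, (forall k, (1 <= m k)%N) &
    {uniform Sigma_seq sigma, (fun k => ifs_iter sigma (m k)) @ \oo --> id}.

End IteratedFunctionSystem.

(* Main.v *)
(* View orbits as sequences with the sup metric d_oo.  A tracing orbit is coded
   by the blocks it follows and by its gaps; with M gap values, words over K
   pairwise separated blocks of length m need at least (K / M)^N orbits in time
   N (m + M).  So zero entropy forces K <= M, uniformly in m: the space of orbits
   is totally bounded for d_oo.  Gluing a long piece of w to the whole of w' then
   yields a time s >= 1 such that w shifted by s is d_oo-close to w': the shift,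
   which is 1-Lipschitz for d_oo, is minimal up to epsilon.  A single return time
   k of one orbit w0 is then a return time of all orbits, so that every sigma is
   uniformly rigid. *)

Require Import Defs.
From mathcomp Require Import all_boot all_order all_algebra.
From mathcomp Require Import all_classical all_reals all_analysis.
From mathcomp Require Import zify lra.

Set Implicit Arguments.
Unset Strict Implicit.
Unset Printing Implicit Defensive.

Import Order.TTheory GRing.Theory Num.Theory.
Import numFieldNormedType.Exports.

Local Open Scope classical_set_scope.
Local Open Scope ring_scope.

(** * Limits superior and finite cardinalities *)

Lemma limn_esup_ge_frequently (R : realType) (u : (\bar R)^nat) (c : \bar R) :
  (forall m, exists2 n, (m <= n)%N & (c <= u n)%E) -> (c <= limn_esup u)%E.
Proof.
move=> cu; apply: le_ereal_inf_tmp => _ [A [m _ mA] <-].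
have [n mn cn] := cu m.
by apply: (le_trans cn); apply: ereal_sup_ubound; exists n => //; exact: mA.
Qed.

Lemma le_limn_esup (R : realType) (u w : (\bar R)^nat) :
  (forall n, (u n <= w n)%E) -> (limn_esup u <= limn_esup w)%E.
Proof.
move=> uw; apply: le_ereal_inf_tmp => _ [A FA <-].
apply: (@le_trans _ _ (ereal_sup (u @` A))).
  by apply: ereal_inf_lbound; exists A.
apply: ge_ereal_sup => _ [n An <-]; apply: (le_trans (uw n)).
by apply: ereal_sup_ubound; exists n.
Qed.

Lemma card_eq_I_inj {T : Type} (S : set T) (k : nat) : (S #= `I_k)%card ->
  exists2 f : T -> nat, (forall x, S x -> (f x < k)%N) &
    forall x y, S x -> S y -> f x = f y -> x = y.
Proof.
move=> /card_set_bijP[f [fS finj _]]; exists f => // x y Sx Sy.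
by apply: finj; rewrite inE.
Qed.

Section GluingEntropy.
Context {R : realType} {X : metricType R} {V : Type}.
Variable v : V -> partial_homeo X.

(** * Orbits as sequences, and the shift *)

Definition orb (p : X * (nat -> V)) (i : nat) : X := ifs_iter v p.2 i p.1.

Lemma ifs_iterD (sigma : nat -> V) (s n : nat) (x : X) :
  ifs_iter v (fun i => sigma (s + i)%N) n (ifs_iter v sigma s x) =
  ifs_iter v sigma (s + n) x.
Proof. by elim: n => [|n IH]; rewrite ?addn0// addnS /= IH. Qed.

Definition orb_shift (s : nat) (p : X * (nat -> V)) : X * (nat -> V) :=
  (orb p s, fun i => p.2 (s + i)%N).

Lemma orb_shiftE s p i : orb (orb_shift s p) i = orb p (s + i).
Proof. exact: ifs_iterD. Qed.

Lemma Psi_shift s p : Psi v p -> Psi v (orb_shift s p).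
Proof.
move=> pPsi n n1 k kn.
have -> : ifs_iter v (orb_shift s p).2 k (orb_shift s p).1 = orb p (s + k).
  exact: orb_shiftE.
by apply: (pPsi (s + n)%N); rewrite ?ltn_add2l// (leq_trans n1)// leq_addl.
Qed.

(** Fixes the scale [eps], and with it [M], before any block length is chosen: numbers of blocks are
    compared with [M] uniformly in their length. *)
Definition gluing_bound (eps : R) (M : nat) : Prop :=
  forall N x s m, orbit_sequence v N x s m ->
    exists t : nat -> nat,
      (forall j, lt_enat j.+1 N -> (1 <= t j <= M)%N) /\
      exists2 p, Psi v p & traced v eps N x s m t p.1 p.2.

Definition separated (m : nat) (eta : R) (K : nat)
    (P : nat -> X * (nat -> V)) : Prop :=
  (forall a, (a < K)%N -> Psi v (P a)) /\
  forall a b, (a < b < K)%N ->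
    exists2 i, (i < m)%N & eta <= mdist (orb (P a) i) (orb (P b) i).

(** * Counting the orbits that trace words of separated blocks *)

Lemma start_eq (m : nat -> option nat) (t t' : nat -> nat) (j : nat) :
  (forall i, (i < j)%N -> t i = t' i) -> start m t j = start m t' j.
Proof. by move=> tt'; apply: eq_bigr => i _; rewrite tt'. Qed.

Lemma start_le (m M : nat) (t : nat -> nat) (j : nat) :
  (forall i, (i < j)%N -> (t i <= M)%N) ->
  (start (fun=> Some m) t j <= j * (m + M))%N.
Proof.
elim: j => [|j IH] tM; first by rewrite /start big_ord0.
have := IH (fun i ij => tM i (leqW ij)); have := tM j (ltnSn j).
by rewrite /start big_ord_recr /= mulSn; lia.
Qed.

(* The spanning point close to a tracing orbit, together with the gaps, determines
   the word f being traced. *)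
Lemma spanning_card_ge (eps : R) (M m K N k : nat) P S :
  gluing_bound eps M -> (1 <= M)%N -> (1 <= m)%N ->
  separated m (4 * eps) K P -> spanning v (N.+1 * (m + M)) eps S ->
  (S #= `I_k)%card -> (K ^ N.+1 <= k * M ^ N.+1)%N.
Proof.
case: M => // M glue _ m1; case: K => [|K] [PPsi Psep] [SPsi Sspan] Sk.
  by rewrite exp0n.
have [g gk ginj] := card_eq_I_inj Sk.
(* Gaps lie between 1 and [M.+1], hence are coded by their predecessors. *)
pose gap (u : {ffun 'I_N.+1 -> 'I_M.+1}) (i : nat) : nat := (u (inord i)).+1.
pose follows (f : {ffun 'I_N.+1 -> 'I_K.+1})
    (c : (X * (nat -> V)) * {ffun 'I_N.+1 -> 'I_M.+1}) :=
  S c.1 /\ forall (j : 'I_N.+1) l, (l < m)%N ->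
    mdist (orb c.1 (start (fun=> Some m) (gap c.2) j + l)) (orb (P (f j)) l)
      < 2 * eps.
have /choice[F FP] f : exists c, follows f c.
  have [|t [tM [z zPsi ztr]]] := glue (Some N.+1)
      (fun j => (P (f (inord j))).1) (fun j => (P (f (inord j))).2)
      (fun=> Some m).
    by split=> // j _; split=> //; rewrite -surjective_pairing; exact: PPsi.
  have [q Sq qz] := Sspan _ zPsi.
  exists (q, [ffun i : 'I_N.+1 => inord (t i).-1]); split=> //= j l lm.
  (* Only the gaps before block [j] affect its start; the value coded at index [N] is arbitrary, as
     [t N] is unconstrained. *)
  have tgap i : (i < j)%N ->
      gap [ffun i : 'I_N.+1 => inord (t i).-1] i = t i.
    move=> ij; have iN : (i < N)%N by rewrite (leq_trans ij)// -ltnS.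
    have /andP[ti0 tiM] := tM i iN.
    have iE : (inord i : 'I_N.+1) = i :> nat by rewrite inordK// ltnW.
    by rewrite /gap ffunE iE inordK prednK.
  rewrite (start_eq _ tgap).
  have sn : (start (fun=> Some m) t j + l < N.+1 * (m + M.+1))%N.
    have : (start (fun=> Some m) t j <= j * (m + M.+1))%N.
      apply: start_le => i ij.
      have iN : (i < N)%N by rewrite (leq_trans ij)// -ltnS.
      by have /andP[] := tM i iN.
    have : (j.+1 * (m + M.+1) <= N.+1 * (m + M.+1))%N.
      by rewrite leq_mul2r ltn_ord orbT.
    by rewrite mulSn; lia.
  have := qz _ sn; have := ztr j (ltn_ord j) l lm.
  rewrite inord_val -!/(orb (_, _) _) -?surjective_pairing -!/(orb _ _).
  have := metric_triangle (orb q (start (fun=> Some m) t j + l))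
    (orb z (start (fun=> Some m) t j + l)) (orb (P (f j)) l).
  rewrite (metric_sym (orb q _) (orb z _)).
  by lra.
pose phi f : 'I_k * {ffun 'I_N.+1 -> 'I_M.+1} :=
  (Ordinal (gk _ (FP f).1), (F f).2).
(* Equal codes give the same spanning point and the same start times, so corresponding blocks are
   both within [2 * eps] of one orbit segment; separation by [4 * eps] makes them equal. *)
have phi_inj : injective phi.
  move=> f f' [eg e2].
  have e1 : (F f).1 = (F f').1 by apply: ginj => //; [case: (FP f)|case: (FP f')].
  have close j l : (l < m)%N ->
      mdist (orb (P (f j)) l) (orb (P (f' j)) l) < 4 * eps.
    move=> lm; have := (FP f).2 j l lm; have := (FP f').2 j l lm.
    rewrite -e1 -e2; set z := orb _ _.
    have := metric_triangle (orb (P (f j)) l) z (orb (P (f' j)) l).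
    by rewrite (metric_sym _ z); lra.
  apply/ffunP => j; apply/eqP; rewrite -val_eqE; case: ltngtP => // ff'.
    have [|i im] := Psep (f j) (f' j); first by rewrite ff' ltn_ord.
    by rewrite leNgt close.
  have [|i im] := Psep (f' j) (f j); first by rewrite ff' ltn_ord.
  by rewrite leNgt metric_sym close.
by have := leq_card _ phi_inj; rewrite card_prod !card_ffun !card_ord.
Qed.


(** * From spanning sets to entropy *)

Lemma min_spanning_ge (n : nat) (eps c : R) :
  (forall S k, spanning v n eps S -> (S #= `I_k)%card -> c <= k%:R) ->
  (c%:E <= min_spanning v n eps)%E.
Proof.
move=> cS; apply: le_ereal_inf_tmp => _ [k [S Sspan Sk] <-].
by rewrite lee_fin; exact: cS Sspan Sk.
Qed.

Lemma le_min_spanning (n : nat) (eps eps' : R) : eps <= eps' ->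
  (min_spanning v n eps' <= min_spanning v n eps)%E.
Proof.
move=> ee'; apply: le_ereal_inf => _ [k [S [SPsi Sspan] Sk] <-].
exists k => //; exists S => //; split=> // p pPsi.
have [q Sq qp] := Sspan p pPsi; exists q => // i /qp.
by move=> /lt_le_trans; apply.
Qed.

Definition entropy_at (eps : R) : \bar R :=
  limn_esup (fun n => (n%:R^-1)%:E * lne (min_spanning v n eps))%E.

Lemma le_entropy_at (eps eps' : R) : eps <= eps' ->
  (entropy_at eps' <= entropy_at eps)%E.
Proof.
move=> ee'; apply: le_limn_esup => n.
apply: lee_wpmul2l; first by rewrite lee_fin invr_ge0.
have min0 e : min_spanning v n e \in `[0, +oo]%E.
  rewrite in_itv /= leey andbT.
  by apply: min_spanning_ge => S k _ _; rewrite ler0n.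
by rewrite lee_lne// le_min_spanning.
Qed.

(** By monotonicity in the scale, the limit at 0 exists and dominates the value at each positive
    scale. *)
Lemma entropy_ge (eps c : R) : 0 < eps -> (c%:E <= entropy_at eps)%E ->
  (c%:E <= entropy v)%E.
Proof.
move=> eps0 ceps; apply: lime_ge.
  apply: nonincreasing_at_right_is_cvge; near=> e => x y _ _.
  exact: le_entropy_at.
near=> e; apply: (le_trans ceps); apply: le_entropy_at.
by near: e; exact: nbhs_right_le.
Unshelve. all: by end_near. Qed.

(** At times [N.+1 * (m + M)] a spanning set has at least [(K / M) ^ N.+1] points, a growth rate of
    [ln (K / M) / (m + M)]. These times are unbounded, which suffices for a limit superior. *)
Lemma separated_entropy_gt0 (eps : R) (M m K : nat) P :
  gluing_bound eps M -> 0 < eps -> (1 <= M)%N -> (1 <= m)%N -> (M < K)%N ->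
  separated m (4 * eps) K P -> (0 < entropy v)%E.
Proof.
move=> glue eps0 M1 m1 MK Psep.
have M0 : 0 < M%:R :> R by rewrite ltr0n.
pose q : R := K%:R / M%:R.
have q1 : 1 < q by rewrite ltr_pdivlMr// mul1r ltr_nat.
have q0 : 0 < q by apply: lt_trans q1.
pose c : R := ln q / (m + M)%:R.
have c0 : 0 < c by rewrite divr_gt0 ?ln_gt0// ltr0n addn_gt0 m1.
apply: (@lt_le_trans _ _ c%:E); first by rewrite lte_fin.
apply: (entropy_ge eps0); apply: limn_esup_ge_frequently => N.
exists (N.+1 * (m + M))%N.
  by rewrite (leq_trans (leqnSn N))// leq_pmulr// addn_gt0 m1.
have qmin : ((q ^+ N.+1)%:E <= min_spanning v (N.+1 * (m + M)) eps)%E.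
  apply: min_spanning_ge => S k Sspan Sk.
  rewrite expr_div_n ler_pdivrMr ?exprn_gt0// -!natrX -natrM ler_nat.
  exact: spanning_card_ge glue _ _ Psep Sspan Sk.
have qlne : ((ln q *+ N.+1)%:E <= lne (min_spanning v (N.+1 * (m + M)) eps))%E.
  have qN0 : 0 <= q ^+ N.+1 by rewrite exprn_ge0// ltW.
  rewrite -lnXn// -lne_EFin ?exprn_gt0// lee_lne//.
    by rewrite in_itv /= lee_fin qN0 leey.
  by rewrite in_itv /= leey andbT (le_trans _ qmin)// lee_fin.
apply: le_trans (lee_wpmul2l _ qlne); last by rewrite lee_fin invr_ge0.
rewrite -EFinM lee_fin /c natrM invfM -[ln q *+ _]mulr_natl mulrACA mulVf ?pnatr_eq0//.
by rewrite mul1r mulrC.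
Qed.

(** * Total boundedness for the sup metric, recurrence and rigidity *)

Lemma bounded_separated_cover (eta : R) (B : nat) (w0 : X * (nat -> V)) :
  (forall m K P, (1 <= m)%N -> separated m eta K P -> (K <= B)%N) ->
  exists K P, (forall a, (a < K)%N -> Psi v (P a)) /\
    forall w, Psi v w -> exists2 a, (a < K)%N &
      forall i, mdist (orb (P a) i) (orb w i) < eta.
Proof.
move=> sepB.
(* A separated set of maximal cardinality over all times m is a net for the sup
   metric: a missed orbit could be added, at a larger m. *)
pose attained K := `[< exists m P, (1 <= m)%N /\ separated m eta K P >].
have attained0 : exists K, attained K.
  exists 0%N; apply/asboolP; exists 1%N, (fun=> w0); split=> //.
  by split=> // a b; rewrite ltn0 andbF.
have attainedB K : attained K -> (K <= B)%N.
  by move=> /asboolP[m [P [m1 Psep]]]; exact: sepB Psep.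
case: (ex_maxnP attained0 attainedB) => K /asboolP[m [P [m1 [PPsi Psep]]]] Kmax.
exists K, P; split=> // w wPsi; apply: contrapT => farw.
have /choice[far farP] (a : 'I_K) :
    exists i, eta <= mdist (orb (P a) i) (orb w i).
  apply: contrapT => neara; apply: farw; exists a => // i.
  by rewrite ltNge; apply/negP => ?; apply: neara; exists i.
suff /Kmax : attained K.+1 by rewrite ltnn.
apply/asboolP; exists (m + \max_a (far a).+1)%N,
  (fun a => if (a < K)%N then P a else w).
split; first by rewrite (leq_trans m1)// leq_addr.
split=> [a _|a b /andP[ab bK]]; first by case: ifPn => // /PPsi.
have aK : (a < K)%N by rewrite (leq_trans ab).
rewrite aK; case: ifPn => [bK'|_].
  have [|i im iab] := Psep a b; first by rewrite ab.
  by exists i => //; rewrite (leq_trans im)// leq_addr.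
exists (far (Ordinal aK)); last exact: (farP (Ordinal aK)).
by apply: leq_trans (leq_addl _ _); exact: (leq_bigmax (Ordinal aK)).
Qed.

Lemma gluing_recurrence (eta : R) (M K : nat) P : gluing_bound eta M ->
  (forall w, Psi v w -> exists2 a, (a < K)%N &
    forall i, mdist (orb (P a) i) (orb w i) < eta) ->
  forall w w', Psi v w -> Psi v w' -> exists2 s, (1 <= s)%N &
    forall i, mdist (orb w (s + i)) (orb w' i) < 4 * eta.
Proof.
move=> glue cover w w' wPsi wPsi'.
(* If [P a] ever leaves [w], take [n] past such a time, so that the premise fails; otherwise any [n]
   works. *)
have /choice[n nP] (a : 'I_K) : exists n,
    (forall i, (i < n)%N -> mdist (orb (P a) i) (orb w i) < 2 * eta) ->
    forall i, mdist (orb (P a) i) (orb w i) < 2 * eta.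
  apply: contrapT => noN; apply: (noN); exists 0%N => _ i.
  apply: contrapT => far; apply: noN; exists i.+1 => near_i.
  by case: far; exact: near_i.
(* An orbit z following w for a time n0 follows it forever, up to 3 eta: the
   centre P a near z does not leave w before n0, hence never does. *)
pose n0 := (\max_a n a).+1.
pose u j := if j is 0%N then w else w'.
pose m j := if j is 0%N then Some n0 else None.
have [|t [tM [z zPsi ztr]]] :=
  glue (Some 2%N) (fun j => (u j).1) (fun j => (u j).2) m.
  split=> // -[|[|//]] _ /=; rewrite -surjective_pairing; split=> //.
have /andP[t1 _] := tM 0%N isT.
have [a aK az] := cover z zPsi.
have zw l : (l < n0)%N -> mdist (orb z l) (orb w l) < eta.
  by move=> /(ztr 0%N isT l); rewrite /start big_ord0 add0n.
have Paw : forall i, mdist (orb (P a) i) (orb w i) < 2 * eta.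
  apply: (nP (Ordinal aK)) => i ina.
  have /zw : (i < n0)%N.
    by rewrite ltnS (leq_trans (ltnW ina))//; exact: (leq_bigmax (Ordinal aK)).
  have := az i; have := metric_triangle (orb (P a) i) (orb z i) (orb w i).
  by rewrite /=; lra.
pose s := start m t 1.
(* Here [s] is [n0 + t 0 - 1], positive because [n0] is a successor and [t 0] is at least 1. *)
have s1 : (1 <= s)%N by rewrite /s /start big_ord1 /= /n0; lia.
exists s => // i.
have := ztr 1%N isT i I; rewrite -/s -!/(orb _ _) /=.
have := az (s + i)%N; have := Paw (s + i)%N.
have := metric_triangle (orb w (s + i)) (orb z (s + i)) (orb w' i).
have := metric_triangle (orb w (s + i)) (orb (P a) (s + i)) (orb z (s + i)).
by rewrite (metric_sym (orb w _) (orb (P a) _)) /orb; lra.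
Qed.

(** A return time [k] of [w0] is inherited by any [w] that a shift of [w0] by some [s] follows:
    compare [w] at 0, [w0] at [s], [w0] at [s + k], [w] at [k]. *)
Lemma entropy0_rigid (delta : R) (w0 : X * (nat -> V)) : gluing_orbit_property v ->
  ~ (0 < entropy v)%E -> Psi v w0 -> 0 < delta ->
  exists2 k, (1 <= k)%N &
    forall w, Psi v w -> mdist (orb w 0) (orb w k) < delta.
Proof.
move=> glue ent0 w0Psi delta0.
(* Three comparisons cost [4 * eta] each. Counting is done at scale [eta / 4], since it requires
   separation by four times its scale. *)
pose eta := delta / 12; have eta0 : 0 < eta by rewrite divr_gt0.
have etaE : delta = 12 * eta by rewrite /eta mulrC divfK.
have eta40 : 0 < eta / 4 by rewrite divr_gt0.
have eta4E : 4 * (eta / 4) = eta by rewrite mulrC divfK.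
have [B B1 glueB] := glue _ eta40.
have [M _ glueM] := glue _ eta0.
have [|K [P [_ cover]]] := @bounded_separated_cover eta B w0.
  move=> m K P m1 Psep; rewrite leqNgt; apply/negP => BK; apply: ent0.
  by apply: (@separated_entropy_gt0 (eta / 4) B m K P); rewrite ?eta4E.
have rec := gluing_recurrence glueM cover.
have [k k1 kw0] := rec _ _ w0Psi w0Psi; exists k => // w wPsi.
have [s _ sw] := rec _ _ w0Psi wPsi.
have := sw 0%N; have := sw k; have := kw0 s.
rewrite addn0 (addnC k s).
have := metric_triangle (orb w 0) (orb w0 s) (orb w k).
have := metric_triangle (orb w0 s) (orb w0 (s + k)) (orb w k).
rewrite (metric_sym (orb w 0) (orb w0 s)).
rewrite (metric_sym (orb w0 s) (orb w0 (s + k))).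
by rewrite etaE; lra.
Qed.

End GluingEntropy.

Theorem theorem3 (R : realType) (X : metricType R) (V : Type)
    (v : V -> partial_homeo X)
    (X_compact : compact [set: X])
    (v_IFS : is_IFS v)
    (v_gluing : gluing_orbit_property v)
    (v_tran : exists sigma : nat -> V,
       Tran v sigma !=set0 /\ ~ uniformly_rigid v sigma) :
  (0 < entropy v)%E.
Proof.
have [sigma [[p [pPsi _]] nrigid]] := v_tran.
apply: contrapT => ent0; apply: nrigid.
(* The return times at scales [1 / (k + 1)] form the rigidity sequence of [sigma]. *)
have /choice[m mP] (k : nat) : exists m, (1 <= m)%N /\
    forall w, Psi v w -> mdist (orb v w 0) (orb v w m) < k.+1%:R^-1.
  have k0 : 0 < k.+1%:R^-1 :> R by rewrite invr_gt0.
  have [m m1 mP] := @entropy0_rigid R X V v _ (p, sigma) v_gluing ent0 pPsi k0.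
  by exists m.
exists m => [k|]; first by have [] := mP k.
move=> Q /uniform_nbhs[E [+ EQ]].
rewrite -entourage_ballE => -[e /= e0 eE].
near=> k; apply: EQ => y ydef; apply: eE => /=.
rewrite ballEmdist /=; apply: (lt_trans ((mP k).2 (y, sigma) ydef)).
by near: k; exact: near_infty_natSinv_lt (PosNum e0).
Unshelve. all: by end_near. Qed.
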